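(* Let $I\subset[0,\infty)$ be an interval with interior $I^{\circ}$, let $f:I\to\mathbb{R}$ be three times differentiable on $I^{\circ}$, and let $a,b\in I^{\circ}$ with $a<b$ be such that $f'''\in L[a,b]$. Suppose that, for some fixed $s\in(0,1]$, the function $|f'''|$ is $s$-convex in the second sense on $[a,b]$. Then $$\left|\int_a^b f(x)\,dx-\frac{b-a}{6}\left[f(a)+4f\left(\frac{a+b}{2}\right)+f(b)\right]\right|\le \frac{(b-a)^4}{6}\left[\frac{2^{-4-s}\left((1+s)(2+s)+34+2^{4+s}(-2+s)+11s+s^2\right)}{(1+s)(2+s)(3+s)(4+s)}\right]\left[|f'''(a)|+|f'''(b)|\right].$$
   Context: $L[a,b]$ denotes the Lebesgue integrable functions on $[a,b]$. For fixed $s\in(0,1]$, a real-valued function $g$ is $s$-convex in the second sense on $[a,b]\subset[0,\infty)$ if $g(\alpha x+\beta y)\le \alpha^s g(x)+\beta^s g(y)$ for all $x,y\in[a,b]$ and all $\alpha,\beta\ge 0$ with $\alpha+\beta=1$. *)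

(* Defs.v *)
From mathcomp Require Import all_boot all_order all_algebra.
From mathcomp Require Import all_classical all_reals all_analysis.

Set Implicit Arguments.
Unset Strict Implicit.
Unset Printing Implicit Defensive.

Import Order.TTheory GRing.Theory Num.Theory.
Import numFieldNormedType.Exports.

Local Open Scope ring_scope.
Local Open Scope classical_set_scope.

(* s-convexity in the second sense of g on D. It is meant for 0 < s <= 1 and
   D an interval of nonnegative reals; the power is the real one, with
   0 `^ s = 0 since s != 0. *)
Definition s_convex2 (R : realType) (s : R) (D : set R) (g : R -> R) : Prop :=
  forall x y : R, D x -> D y ->
  forall u v : R, 0 <= u -> 0 <= v -> u + v = 1 ->
    g (u * x + v * y) <= u `^ s * g x + v `^ s * g y.

(* Main.v *)
Require Import Defs.
From mathcomp Require Import all_boot all_order all_algebra.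
From mathcomp Require Import all_classical all_reals all_analysis.
From mathcomp Require Import ring lra.
Set Implicit Arguments.
Unset Strict Implicit.
Unset Printing Implicit Defensive.
Import Order.TTheory GRing.Theory Num.Theory.
Import numFieldNormedType.Exports.
Local Open Scope ring_scope.
Local Open Scope classical_set_scope.

(** Simpson's error is studied as a function of the half-width.  With
    m = (a + b) / 2 and F a primitive of f, put
      E t = F (m + t) - F (m - t) - t / 3 (f (m - t) + 4 f m + f (m + t)),
    so that the quantity to bound is E at the half-length of [a, b].  The
    coefficients of the rule make E, E' and E'' vanish at 0, and
      E''' t = - t / 3 (f''' (m + t) - f''' (m - t)).
    After rescaling [a, b] to [0, 1], adding the s-convexity inequalities at
    the two symmetric points 1/2 + t and 1/2 - t gives, for a constant C
    proportional to |f''' a| + |f''' b|,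
      |E''' t| <= C / 3 * t ((1/2 + t) ^ s + (1/2 - t) ^ s).
    The right-hand side is C / 3 (q (1/2 + t) - q (1/2 - t)) with
    q x = (x - 1/2) x ^ s, whose iterated primitives are combinations of two
    powers ([weight_prim3]).  The third primitive w of this bound that vanishes
    to second order at 0 therefore dominates |E|: between functions vanishing
    at 0, domination follows from domination of the derivatives, and this is
    used three times ([norm_le_of_derive_le], [norm_simpson_defect_le]).
    Evaluating w at 1/2 yields the stated constant ([simpson_constE]).

    Only pointwise derivatives of f'' occur, so f''' is never integrated and
    no fundamental theorem of calculus for discontinuous derivatives enters;
    the one function integrated is f itself, which is continuous
    ([continuous_antiderivative]). *)

(** * Domination from derivatives *)

Section Comparison.
Context {R : realType}.
Implicit Types (e w f : R -> R) (h m t : R).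

(** Both w - e and w + e have a nonnegative derivative.  The interval is open
    at h because the dominating functions to come involve powers x ^ r whose
    base x reaches 0 at the end, where they lose two-sided derivatives. *)
Lemma norm_le_of_derive_le e e' w w' h :
  (forall t, 0 <= t < h -> is_derive t 1 e (e' t)) ->
  (forall t, 0 <= t < h -> is_derive t 1 w (w' t)) ->
  (forall t, 0 <= t < h -> `|e' t| <= w' t) ->
  e 0 = 0 -> w 0 = 0 -> forall t, 0 <= t < h -> `|e t| <= w t.
Proof.
move=> de dw ew e0 w0 t /andP[t0 th].
have nonneg (g g' : R -> R) :
    (forall x, 0 <= x < h -> is_derive x 1 g (g' x)) ->
    (forall x, 0 <= x < h -> 0 <= g' x) -> g 0 = 0 -> 0 <= g t.
  move=> dg g'0 g0; rewrite -g0.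
  apply: (@ger0_derive1_le_co R g 0 h) => //.
  - move=> x; rewrite in_itv/= => /andP[/ltW x0 xh].
    by have [] := dg x; rewrite ?x0.
  - move=> x; rewrite in_itv/= => /andP[/ltW x0 xh].
    have [|_ dgx] := dg x; first by rewrite x0.
    by rewrite derive1E dgx g'0// x0.
  - apply: derivable_within_continuous => x; rewrite in_itv/= => xh.
    by have [] := dg x xh.
  - by rewrite in_itv/= lexx (le_lt_trans t0 th).
  - by rewrite in_itv/= t0.
rewrite ler_norml -subr_ge0 opprK -(subr_ge0 (e t)); apply/andP; split.
- apply: (nonneg (e + w) (fun x => e' x + w' x)).
  + by move=> x xh; apply: is_deriveD; [exact: de|exact: dw].
  + move=> x xh; have := ew x xh; rewrite ler_norml => /andP[+ _]; lra.
  + by rewrite -[LHS]/(e 0 + w 0) e0 w0 addr0.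
- apply: (nonneg (w - e) (fun x => w' x - e' x)).
  + by move=> x xh; apply: is_deriveB; [exact: dw|exact: de].
  + move=> x xh; have := ew x xh; rewrite ler_norml => /andP[_]; lra.
  + by rewrite -[LHS]/(w 0 - e 0) e0 w0 subr0.
Qed.

(** Recovers the endpoint excluded in [norm_le_of_derive_le]. *)
Lemma norm_le_at_end e w h : 0 < h ->
  {for h, continuous e} -> {for h, continuous w} ->
  (forall t, 0 <= t < h -> `|e t| <= w t) -> `|e h| <= w h.
Proof.
move=> h0 ce cw ew.
have ce' : `|e t| @[t --> h^'-] --> `|e h|.
  by apply: cvg_norm; apply: cvg_at_left_filter; exact: ce.
have cw' : w t @[t --> h^'-] --> w h by apply: cvg_at_left_filter; exact: cw.
apply: (ler_cvg_to ce' cw').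
near=> t; apply: ew; apply/andP; split.
- by near: t; exact: nbhs_left_ge.
- by near: t; exact: nbhs_left_lt.
Unshelve. all: by end_near. Qed.

(** * Simpson's error as a function of the half-width *)

Definition sym_sum m f t := f (m + t) + f (m - t).
Definition sym_diff m f t := f (m + t) - f (m - t).

(** Variant of [is_derive_eq] whose first derivative is an ordinary argument
    instead of a class instance to be searched for. *)
Lemma is_derive_eq_val f t d d' : is_derive t 1 f d -> d = d' ->
  is_derive t 1 f d'.
Proof. by move=> + <-. Qed.

Lemma is_derive_forward m f t d :
  is_derive (m + t) 1 f d -> is_derive t 1 (fun x => f (m + x)) d.
Proof.
move=> df.
have dm : is_derive t (1 : R) (fun x => m + x) 1.
  by rewrite -[X in is_derive _ _ _ X]add0r; exact: is_deriveD.
by have := is_derive1_comp df dm; rewrite mulr1.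
Qed.

Lemma is_derive_backward m f t d :
  is_derive (m - t) 1 f d -> is_derive t 1 (fun x => f (m - x)) (- d).
Proof.
move=> df.
have dm : is_derive t (1 : R) (fun x => m - x) (- 1).
  by rewrite -[X in is_derive _ _ _ X]add0r; exact: is_deriveB.
have := @is_derive1_comp R f (fun x => m - x) t d (- 1) df dm.
by rewrite mulrN1.
Qed.

Lemma is_derive_sym_sum m f f' t :
  is_derive (m + t) 1 f (f' (m + t)) -> is_derive (m - t) 1 f (f' (m - t)) ->
  is_derive t 1 (sym_sum m f) (sym_diff m f' t).
Proof.
by move=> /is_derive_forward df /is_derive_backward db; exact: is_deriveD.
Qed.

Lemma is_derive_sym_diff m f f' t :
  is_derive (m + t) 1 f (f' (m + t)) -> is_derive (m - t) 1 f (f' (m - t)) ->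
  is_derive t 1 (sym_diff m f) (sym_sum m f' t).
Proof.
move=> /is_derive_forward df /is_derive_backward db.
by rewrite /sym_sum -(opprK (f' (m - t))); exact: is_deriveB.
Qed.

Lemma is_derive_mul_id f t d : is_derive t 1 f d ->
  is_derive t 1 (fun x => x * f x) (f t + t * d).
Proof.
move=> df; have di := is_derive_id t (1 : R).
have := is_deriveM di df; rewrite /GRing.scale /= mulr1 addrC; exact.
Qed.

(** When F is a primitive of f, this is the error of Simpson's rule on
    [m - t, m + t]. *)
Definition simpson_defect m F f t :=
  sym_diff m F t - t * (3^-1 * (sym_sum m f t + 4 * f m)).

Lemma is_derive_scale k f t d : is_derive t 1 f d ->
  is_derive t 1 (fun x => k * f x) (k * d).
Proof. by move=> df; exact: is_deriveZ. Qed.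

Lemma is_derive_addc c f t d : is_derive t 1 f d ->
  is_derive t 1 (fun x => f x + c) d.
Proof.
by move=> df; rewrite -[d]addr0; exact: is_deriveD.
Qed.

Lemma is_derive_sub_fun f g t d d' : is_derive t 1 f d -> is_derive t 1 g d' ->
  is_derive t 1 (fun x => f x - g x) (d - d').
Proof. by move=> df dg; exact: is_deriveB. Qed.

(** In the third derivative of the defect the weights 1/3, 4/3, 1/3 of the rule
    cancel every term but the one in f3, and the defect and its first two
    derivatives e1, e2 vanish at 0; so domination propagates back from the
    third derivatives. *)
Lemma norm_simpson_defect_le m h (F f f1 f2 f3 w w1 w2 w3 : R -> R) :
  (forall x, m - h < x < m + h -> is_derive x 1 F (f x)) ->
  (forall x, m - h < x < m + h -> is_derive x 1 f (f1 x)) ->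
  (forall x, m - h < x < m + h -> is_derive x 1 f1 (f2 x)) ->
  (forall x, m - h < x < m + h -> is_derive x 1 f2 (f3 x)) ->
  (forall t, 0 <= t < h -> is_derive t 1 w (w1 t)) ->
  (forall t, 0 <= t < h -> is_derive t 1 w1 (w2 t)) ->
  (forall t, 0 <= t < h -> is_derive t 1 w2 (w3 t)) ->
  w 0 = 0 -> w1 0 = 0 -> w2 0 = 0 ->
  (forall t, 0 <= t < h -> `|t * (3^-1 * sym_diff m f3 t)| <= w3 t) ->
  forall t, 0 <= t < h -> `|simpson_defect m F f t| <= w t.
Proof.
move=> dF df df1 df2 dw dw1 dw2 w0 w10 w20 w3_ge.
have inm t : 0 <= t < h -> m - h < m + t < m + h by move=> ?; lra.
have inp t : 0 <= t < h -> m - h < m - t < m + h by move=> ?; lra.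
have dsum g g' t : (forall x, m - h < x < m + h -> is_derive x 1 g (g' x)) ->
    0 <= t < h -> is_derive t 1 (sym_sum m g) (sym_diff m g' t).
  move=> dg th; apply: is_derive_sym_sum; apply: dg; first exact: inm.
  exact: inp.
have ddiff g g' t : (forall x, m - h < x < m + h -> is_derive x 1 g (g' x)) ->
    0 <= t < h -> is_derive t 1 (sym_diff m g) (sym_sum m g' t).
  move=> dg th; apply: is_derive_sym_diff; apply: dg; first exact: inm.
  exact: inp.
pose e1 t := (2 / 3 * sym_sum m f t + - (4 / 3 * f m))
  - t * (3^-1 * sym_diff m f1 t).
pose e2 t := 3^-1 * sym_diff m f1 t - t * (3^-1 * sym_sum m f2 t).
pose e3 t := - (t * (3^-1 * sym_diff m f3 t)).
have de t : 0 <= t < h -> is_derive t 1 (simpson_defect m F f) (e1 t).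
  move=> th; have := is_derive_sub_fun (ddiff _ _ _ dF th) (is_derive_mul_id
    (is_derive_scale 3^-1 (is_derive_addc (4 * f m) (dsum _ _ _ df th)))).
  by move/is_derive_eq_val; apply; rewrite /e1; field.
have de1 t : 0 <= t < h -> is_derive t 1 e1 (e2 t).
  move=> th; have := is_derive_sub_fun
    (is_derive_addc (- (4 / 3 * f m))
      (is_derive_scale (2 / 3) (dsum _ _ _ df th)))
    (is_derive_mul_id (is_derive_scale 3^-1 (ddiff _ _ _ df1 th))).
  by move/is_derive_eq_val; apply; rewrite /e2; field.
have de2 t : 0 <= t < h -> is_derive t 1 e2 (e3 t).
  move=> th; have := is_derive_sub_fun
    (is_derive_scale 3^-1 (ddiff _ _ _ df1 th))
    (is_derive_mul_id (is_derive_scale 3^-1 (dsum _ _ _ df2 th))).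
  by move/is_derive_eq_val; apply; rewrite /e3; field.
have e30 t : 0 <= t < h -> `|e3 t| <= w3 t by rewrite normrN; exact: w3_ge.
apply: (norm_le_of_derive_le de dw) => //; last first.
  by rewrite /simpson_defect /sym_diff subr0 addr0; ring.
apply: (norm_le_of_derive_le de1 dw1) => //; last first.
  by rewrite /e1 /sym_sum subr0 addr0; field.
apply: (norm_le_of_derive_le de2 dw2) => //.
by rewrite /e2 /sym_diff subr0 addr0; ring.
Qed.

End Comparison.

(** * The dominating function on the unit interval *)

Section Powers.
Context {R : realType}.
Implicit Types (A B r s x : R).

Definition pow_comb A B r x := A * x `^ (r + 1) - B * x `^ r.

Lemma is_derive_pow_comb A B r x : 0 < x ->
  is_derive x 1 (pow_comb A B r) (pow_comb (A * (r + 1)) (B * r) (r - 1) x).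
Proof.
move=> x0; have dp (p : R) := @is_derive1_powR R p x x0.
have := is_derive_sub_fun (is_derive_scale A (dp (r + 1)))
  (is_derive_scale B (dp r)).
by move/is_derive_eq_val; apply; rewrite /pow_comb addrK subrK !mulrA.
Qed.

(** Iterated primitives of [weight], read off from the form
    x ^ (s + 1) - x ^ s / 2 of (x - 1/2) x ^ s. *)
Definition weight_prim3 s := pow_comb ((s + 2) * (s + 3) * (s + 4))^-1
                    (2 * (s + 1) * (s + 2) * (s + 3))^-1 (s + 3).
Definition weight_prim2 s := pow_comb ((s + 2) * (s + 3))^-1
                    (2 * (s + 1) * (s + 2))^-1 (s + 2).
Definition weight_prim1 s := pow_comb (s + 2)^-1 (2 * (s + 1))^-1 (s + 1).
Definition weight s x := (x - 2^-1) * x `^ s.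

Lemma is_derive_weight_prim3 s x : 0 < s -> 0 < x ->
  is_derive x 1 (weight_prim3 s) (weight_prim2 s x).
Proof.
move=> s0 x0; apply: (is_derive_eq_val (is_derive_pow_comb _ _ _ x0)).
rewrite /weight_prim2; congr pow_comb; last by ring.
all: by field; rewrite ?andbT; do ?[apply/andP; split]; apply: lt0r_neq0; lra.
Qed.

Lemma is_derive_weight_prim2 s x : 0 < s -> 0 < x ->
  is_derive x 1 (weight_prim2 s) (weight_prim1 s x).
Proof.
move=> s0 x0; apply: (is_derive_eq_val (is_derive_pow_comb _ _ _ x0)).
rewrite /weight_prim1; congr pow_comb; last by ring.
all: by field; rewrite ?andbT; do ?[apply/andP; split]; apply: lt0r_neq0; lra.
Qed.

Lemma is_derive_weight_prim1 s x : 0 < s -> 0 < x ->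
  is_derive x 1 (weight_prim1 s) (weight s x).
Proof.
move=> s0 x0; apply: (is_derive_eq_val (is_derive_pow_comb _ _ _ x0)).
rewrite /pow_comb subrK addrK powRD ?powRr1 ?(ltW x0)//; last first.
  by rewrite (lt0r_neq0 x0) implybT.
by rewrite /weight; field; do ?[apply/andP; split]; apply: lt0r_neq0; lra.
Qed.

(** Value at t = 1/2 of the third primitive of
    t ((1/2 + t) ^ s + (1/2 - t) ^ s) vanishing to second order at 0; the term
    in (1/2 - t) ^ (s + 3) has disappeared. *)
Definition simpson_const s :=
  weight_prim3 s 1 - 2 * weight_prim3 s 2^-1 - weight_prim1 s 2^-1 / 4.

(** The dominating function w is C / 3 times the third primitive of
    t ((1/2 + t) ^ s + (1/2 - t) ^ s) vanishing to second order at 0.  It is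
    the symmetrization of [weight_prim3] minus its Taylor polynomial of degree
    two; the linear coefficient vanishes by symmetry. *)
Lemma norm_simpson_unit_le s C (F f f1 f2 f3 : R -> R) : 0 < s -> 0 <= C ->
  (forall x, 0 <= x <= 1 -> is_derive x 1 F (f x)) ->
  (forall x, 0 <= x <= 1 -> is_derive x 1 f (f1 x)) ->
  (forall x, 0 <= x <= 1 -> is_derive x 1 f1 (f2 x)) ->
  (forall x, 0 <= x <= 1 -> is_derive x 1 f2 (f3 x)) ->
  (forall x, 0 <= x <= 1 -> `|f3 x| + `|f3 (1 - x)| <=
     C * (x `^ s + (1 - x) `^ s)) ->
  `|F 1 - F 0 - (f 0 + 4 * f 2^-1 + f 1) / 6| <=
    C / 3 * simpson_const s.
Proof.
move=> s0 C0 dF df df1 df2 f3_le.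
pose w t := C / 3 *
  (sym_sum 2^-1 (weight_prim3 s) t - t * (weight_prim1 s 2^-1 * t)
   - 2 * weight_prim3 s 2^-1).
pose w1 t := C / 3 *
  (sym_diff 2^-1 (weight_prim2 s) t - 2 * weight_prim1 s 2^-1 * t).
pose w2 t := C / 3 *
  (sym_sum 2^-1 (weight_prim1 s) t - 2 * weight_prim1 s 2^-1).
pose w3 t := C / 3 * sym_diff 2^-1 (weight s) t.
have did (t : R) : is_derive t 1 (fun x => x) 1 by exact: is_derive_id.
have wE t : 0 <= t < 2^-1 -> `|simpson_defect 2^-1 F f t| <= w t.
  move: t; refine (@norm_simpson_defect_le _ _ _ _ _ f1 f2 f3 w w1 w2 w3
    _ _ _ _ _ _ _ _ _ _ _).
  - by move=> x xI; apply: dF; lra.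
  - by move=> x xI; apply: df; lra.
  - by move=> x xI; apply: df1; lra.
  - by move=> x xI; apply: df2; lra.
  - move=> t tI; have := is_derive_scale (C / 3)
      (is_derive_addc (- (2 * weight_prim3 s 2^-1)) (is_derive_sub_fun
        (@is_derive_sym_sum _ 2^-1 (weight_prim3 s) (weight_prim2 s) t
          (is_derive_weight_prim3 s0 _) (is_derive_weight_prim3 s0 _))
        (is_derive_mul_id (is_derive_scale (weight_prim1 s 2^-1) (did t))))).
    by move=> /(_ _ _)/is_derive_eq_val; apply; [lra|lra|rewrite /w1; ring].
  - move=> t tI; have := is_derive_scale (C / 3) (is_derive_sub_fun
      (@is_derive_sym_diff _ 2^-1 (weight_prim2 s) (weight_prim1 s) t
        (is_derive_weight_prim2 s0 _) (is_derive_weight_prim2 s0 _))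
      (is_derive_scale (2 * weight_prim1 s 2^-1) (did t))).
    by move=> /(_ _ _)/is_derive_eq_val; apply; [lra|lra|rewrite /w2; ring].
  - move=> t tI; have := is_derive_scale (C / 3)
      (is_derive_addc (- (2 * weight_prim1 s 2^-1))
        (@is_derive_sym_sum _ 2^-1 (weight_prim1 s) (weight s) t
          (is_derive_weight_prim1 s0 _) (is_derive_weight_prim1 s0 _))).
    by apply; lra.
  - by rewrite /w /sym_sum subr0 addr0; ring.
  - by rewrite /w1 /sym_diff subr0 addr0; ring.
  - by rewrite /w2 /sym_sum subr0 addr0; ring.
  - move=> t /andP[t0 th].
    have -> : w3 t = t * (3^-1 *
        (C * ((2^-1 + t) `^ s + (1 - (2^-1 + t)) `^ s))).
      have -> : 1 - (2^-1 + t) = 2^-1 - t by lra.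
      by rewrite /w3 /sym_diff /weight; ring.
    rewrite normrM (ger0_norm t0) ler_wpM2l// normrM ger0_norm ?invr_ge0//.
    rewrite ler_wpM2l ?invr_ge0//.
    apply: le_trans (f3_le (2^-1 + t) _); last by apply/andP; split; lra.
    rewrite (_ : 1 - (2^-1 + t) = 2^-1 - t); last by lra.
    exact: ler_normB.
set k := ((s + 2) * (s + 3) * (s + 4))^-1.
have k0 : 0 <= k by rewrite invr_ge0 !mulr_ge0//; lra.
(* At t = 1/2 the base 1/2 - t reaches 0.  Since r ^ (s + 4) <= r for
   0 < r <= 1, replacing the leading power of r = 1/2 - t by r and dropping the
   other one gives a majorant v of w that is differentiable at 1/2 and whose
   value there is that of w. *)
pose v t := C / 3 * (weight_prim3 s (2^-1 + t) + k * (2^-1 - t)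
   - t * (weight_prim1 s 2^-1 * t) - 2 * weight_prim3 s 2^-1).
have wv t : 0 <= t < 2^-1 -> w t <= v t.
  move=> /andP[t0 th]; rewrite ler_wpM2l ?divr_ge0// !lerD2r lerD2l.
  rewrite {1}/weight_prim3 /pow_comb -/k.
  set b := (2 * _ * _ * _)^-1.
  have b0 : 0 <= b by rewrite invr_ge0 !mulr_ge0//; lra.
  have p0 : 0 <= b * (2^-1 - t) `^ (s + 3) by rewrite mulr_ge0 ?powR_ge0.
  have : k * (2^-1 - t) `^ (s + 3 + 1) <= k * (2^-1 - t).
    by apply: ler_wpM2l => //; apply: ge1r_powR; [apply/andP; split|]; lra.
  lra.
have half0 : 0 < 2^-1 :> R by rewrite invr_gt0.
have cont (g : R -> R) d :
    is_derive (2^-1 : R) 1 g d -> {for 2^-1, continuous g}.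
  by move=> [dg _]; apply: differentiable_continuous; apply/derivable1_diffP.
have ends x : x = 2^-1 -> 0 <= 2^-1 + x <= 1 /\ 0 <= 2^-1 - x <= 1.
  by move=> ->; split; apply/andP; split; lra.
have : `|simpson_defect 2^-1 F f 2^-1| <= v 2^-1.
  apply: (@norm_le_at_end _ _ v _ half0).
  - have [i1 i2] := ends _ erefl.
    exact: (cont _ _ (is_derive_sub_fun
      (@is_derive_sym_diff _ _ F f _ (dF _ i1) (dF _ i2))
      (is_derive_mul_id (is_derive_scale 3^-1 (is_derive_addc (4 * f 2^-1)
        (@is_derive_sym_sum _ _ f f1 _ (df _ i1) (df _ i2))))))).
  - have i1 : 0 < 2^-1 + 2^-1 :> R by rewrite addr_gt0.
    have := is_derive_scale (C / 3)
      (is_derive_addc (- (2 * weight_prim3 s 2^-1)) (is_derive_sub_fun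
        (is_deriveD (is_derive_forward (is_derive_weight_prim3 s0 i1))
          (is_derive_scale k (is_derive_backward (did (2^-1 - 2^-1)))))
        (is_derive_mul_id (is_derive_scale (weight_prim1 s 2^-1) (did 2^-1))))).
    exact: cont.
  - by move=> t tI; apply: le_trans (wE t tI) (wv t tI).
rewrite /simpson_defect /simpson_const /v /sym_diff /sym_sum subrr.
rewrite (_ : 2^-1 + 2^-1 = 1 :> R); last by lra.
congr (_ <= _); first by congr `|_|; field.
by field.
Qed.

Lemma simpson_constE s : 0 < s ->
  simpson_const s =
  (2 `^ (- 4 - s)
        * ((1 + s) * (2 + s) + 34 + 2 `^ (4 + s) * (- 2 + s) + 11 * s + s ^+ 2)
        / ((1 + s) * (2 + s) * (3 + s) * (4 + s))) / 2.
Proof.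
move=> s0.
(* Every power of 2 and of 1/2 is rewritten in terms of P = 2 ^ (4 + s), which
   leaves an identity between rational functions of s and P. *)
set P := (2 : R) `^ (4 + s).
have P0 : P != 0 by rewrite lt0r_neq0 ?powR_gt0.
have -> : (2 : R) `^ (- 4 - s) = P^-1.
  by rewrite /P -powRN; congr (_ `^ _); ring.
have pE (n : nat) : (n <= 4)%N -> (2^-1 : R) `^ (s + (4 - n)%:R) = 2 ^+ n / P.
  move=> n4; rewrite -[2^-1 in LHS]powR_inv1// -powRrM mulN1r powRN.
  have -> : P = 2 `^ (s + (4 - n)%:R) * 2 ^+ n.
    rewrite -powR_mulrn// -powRD ?pnatr_eq0 ?implybT// -addrA -natrD subnK//.
    by rewrite addrC.
  by rewrite invfM mulrCA mulfV ?mulr1// expf_neq0.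
rewrite /simpson_const /weight_prim3 /weight_prim1 /pow_comb !powR1.
rewrite -(addrA s 3) -(addrA s 1).
have p1 : (2^-1 : R) `^ (s + 1) = 2 ^+ 3 / P by exact: (pE 3).
have p2 : (2^-1 : R) `^ (s + (1 + 1)) = 2 ^+ 2 / P by exact: (pE 2).
have p3 : (2^-1 : R) `^ (s + 3) = 2 ^+ 1 / P by exact: (pE 1).
have p4 : (2^-1 : R) `^ (s + (3 + 1)) = 2 ^+ 0 / P.
  have -> : 3 + 1 = 4 :> R by ring.
  exact: (pE 0).
rewrite p1 p2 p3 p4 -/P.
by field; do ?[apply/andP; split] => //; apply: lt0r_neq0; lra.
Qed.

End Powers.

(** * Simpson's inequality on a segment *)

Section Simpson.
Context {R : realType}.
Implicit Types (f : R -> R) (a b s x : R).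
Local Notation mu := (@lebesgue_measure R).

Lemma is_derive_affine f a l x d :
  is_derive (a + l * x) 1 f d -> is_derive x 1 (fun y => f (a + l * y)) (l * d).
Proof.
move=> df.
have dl : is_derive x 1 (fun y => a + l * y) l.
  rewrite -[X in is_derive _ _ _ X]add0r -[X in 0 + X]mulr1.
  exact: (is_deriveD (is_derive_cst a x 1)
    (is_derive_scale l (is_derive_id x (1 : R)))).
by have := @is_derive1_comp R f (fun y => a + l * y) x d l df dl; rewrite mulrC.
Qed.

(** The s-convexity inequalities at two points symmetric about the midpoint
    exchange the weights of g a and g b; hence only g a + g b appears. *)
Lemma s_convex2_sym_le s a b (g : R -> R) x : a <= b -> s_convex2 s `[a, b] g ->
  0 <= x <= 1 ->
  g (a + (b - a) * x) + g (a + (b - a) * (1 - x)) <=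
    (g a + g b) * (x `^ s + (1 - x) `^ s).
Proof.
move=> ab gconv /andP[x0 x1].
have aI : `[a, b]%classic a by rewrite /= in_itv/= lexx.
have bI : `[a, b]%classic b by rewrite /= in_itv/= ab lexx.
have x1' : 0 <= 1 - x by rewrite subr_ge0.
have g1 : g (a + (b - a) * x) <= (1 - x) `^ s * g a + x `^ s * g b.
  have := gconv a b aI bI (1 - x) x x1' x0 (subrK _ _).
  by congr (g _ <= _); ring.
have g2 : g (a + (b - a) * (1 - x)) <= x `^ s * g a + (1 - x) `^ s * g b.
  have := gconv a b aI bI x (1 - x) x0 x1' (subrKC _ _).
  by congr (g _ <= _); ring.
by apply: le_trans (lerD g1 g2) _; rewrite le_eqVlt; apply/predU1P; left; ring.
Qed.

(** With l = b - a, the change of variable x |-> a + l x multiplies the k-th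
    derivative of a primitive by l ^ k, whence the factor l ^ 4 for f3. *)
Lemma norm_simpson_s_convex_le s a b (F f f1 f2 f3 : R -> R) :
  0 < s -> a < b ->
  (forall x, a <= x <= b -> is_derive x 1 F (f x)) ->
  (forall x, a <= x <= b -> is_derive x 1 f (f1 x)) ->
  (forall x, a <= x <= b -> is_derive x 1 f1 (f2 x)) ->
  (forall x, a <= x <= b -> is_derive x 1 f2 (f3 x)) ->
  s_convex2 s `[a, b] (fun x => `|f3 x|) ->
  `|F b - F a - (b - a) / 6 * (f a + 4 * f ((a + b) / 2) + f b)| <=
  (b - a) ^+ 4 * (`|f3 a| + `|f3 b|) / 3 * simpson_const s.
Proof.
move=> s0 ab dF df df1 df2 f3conv; set l := b - a.
have l0 : 0 < l by rewrite subr_gt0.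
have aff x : 0 <= x <= 1 -> a <= a + l * x <= b.
  move=> /andP[x0 x1]; rewrite lerDl mulr_ge0 ?(ltW l0)//=.
  by rewrite -lerBrDl -/l; apply: ler_piMr => //; exact: ltW.
have := @norm_simpson_unit_le R s (l ^+ 4 * (`|f3 a| + `|f3 b|))
  (fun x => F (a + l * x)) (fun x => l * f (a + l * x))
  (fun x => l * (l * f1 (a + l * x))) (fun x => l * (l * (l * f2 (a + l * x))))
  (fun x => l * (l * (l * (l * f3 (a + l * x))))) s0.
rewrite mulr1 mulr0 addr0 /l (subrKC a b) -/l.
rewrite (_ : a + l * 2^-1 = (a + b) / 2); last by rewrite /l; field.
rewrite (_ : (_ + _ + _) / 6 = l / 6 * (f a + 4 * f ((a + b) / 2) + f b));
  last by field.
apply.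
- by apply: mulr_ge0; [apply: exprn_ge0; exact: ltW|exact: addr_ge0].
- by move=> x /aff xI; exact: is_derive_affine (dF _ xI).
- by move=> x /aff xI; exact: is_derive_scale (is_derive_affine (df _ xI)).
- move=> x /aff xI.
  exact: is_derive_scale (is_derive_scale _ (is_derive_affine (df1 _ xI))).
- move=> x /aff xI; exact: (is_derive_scale _ (is_derive_scale _
    (is_derive_scale _ (is_derive_affine (df2 _ xI))))).
- move=> x xI.
  have nE y : `|l * (l * (l * (l * y)))| = l ^+ 4 * `|y|.
    by rewrite !normrM !(gtr0_norm l0); ring.
  rewrite !nE -mulrDr -[leRHS]mulrA; apply: ler_wpM2l.
    by apply: exprn_ge0; exact: ltW.
  exact: (s_convex2_sym_le (ltW ab) f3conv).
Qed.

(** The primitive lives on a segment strictly larger than [a, b], so that it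
    has two-sided derivatives at a and b too. *)
Lemma continuous_antiderivative (c u : R) f : c < u ->
  (forall x, c <= x <= u -> {for x, continuous f}) ->
  exists F : R -> R, (forall x, c < x < u -> is_derive x 1 F (f x)) /\
    forall a b, c < a -> a < b -> b < u ->
    \int[mu]_(x in `[a, b]) f x = F b - F a.
Proof.
move=> cu cf.
have intf : mu.-integrable `[c, u] (EFin \o f).
  apply: continuous_compact_integrable; first exact: segment_compact.
  apply: continuous_in_subspaceT => x; rewrite inE/= in_itv/=; exact: cf.
exists (fun x => \int[mu]_(t in `[c, x]) f t); split.
  move=> x /andP[cx xu].
  have cfx : {for x, continuous f} by apply: cf; rewrite !ltW.
  have [dF FE] := continuous_FTC1_closed xu intf cx cfx.
  by rewrite -FE derive1E; exact: DeriveDef.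
move=> a b ca ab bu.
have intb : mu.-integrable `[c, b] (EFin \o f).
  by apply: integrableS intf => //; apply: subset_itvl; rewrite bnd_simp ltW.
rewrite Rintegral_itvB ?bnd_simp ?(ltW ca) ?(ltW ab)//.
rewrite Rintegral_itv_obnd_cbnd//.
apply: integrableS intb => // x /=; rewrite !in_itv/= => /andP[ax ->].
by rewrite andbT ltW// (lt_trans ca).
Qed.

Lemma interior_interval_extend (I : set R) a b : is_interval I ->
  I° a -> I° b ->
  exists c u, [/\ c < a, b < u & forall x, c <= x <= u -> I° x].
Proof.
move=> I_itv aI bI.
have [e/= e0 eI] := (nbhs_ballP _ _).1 aI.
have [d/= d0 dI] := (nbhs_ballP _ _).1 bI.
have Ic : I (a - e / 2).
  by apply: eI; rewrite /ball/= opprB addrC subrK gtr0_norm; lra.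
have Iu : I (b + d / 2).
  by apply: dI; rewrite /ball/= opprD addrA subrr add0r normrN gtr0_norm; lra.
(* Halving the offsets keeps a margin, so that the endpoints are interior. *)
exists (a - e / 4), (b + d / 4); split; [lra|lra|move=> x /andP[cx xu]].
apply/nbhs_ballP; exists (Num.min (e / 4) (d / 4)) => /=.
  by rewrite lt_min; apply/andP; split; lra.
move=> y; rewrite /ball/= lt_min ltr_distl => /andP[/andP[? ?]].
rewrite ltr_distl => /andP[? ?].
by apply: (I_itv _ _ Ic Iu); apply/andP; split; lra.
Qed.

End Simpson.

Theorem theorem2 (R : realType) (I : set R) (f : R -> R) (a b s : R)
  (I_itv : is_interval I)
  (I_ge0 : I `<=` [set x | 0 <= x])
  (f_diff3 : forall x : R, interior I x ->
     forall k : nat, (k < 3)%N -> derivable (f^`(k)) x 1)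
  (aI : interior I a) (bI : interior I b) (ab : a < b)
  (f3_L1 : (@lebesgue_measure R).-integrable `[a, b] (EFin \o f^`(3)))
  (s_gt0 : 0 < s) (s_le1 : s <= 1)
  (f3_sconv : s_convex2 s `[a, b] (fun x => `|f^`(3) x|)) :
  `| \int[@lebesgue_measure R]_(x in `[a, b]) f x
     - (b - a) / 6 * (f a + 4 * f ((a + b) / 2) + f b) |
  <= (b - a) ^+ 4 / 6
     * (2 `^ (- 4 - s)
        * ((1 + s) * (2 + s) + 34 + 2 `^ (4 + s) * (- 2 + s) + 11 * s + s ^+ 2)
        / ((1 + s) * (2 + s) * (3 + s) * (4 + s)))
     * (`|f^`(3) a| + `|f^`(3) b|).
Proof.
have [c [u [ca bu cuI]]] := interior_interval_extend I_itv aI bI.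
have fk k x : (k < 3)%N -> c <= x <= u -> is_derive x 1 (f^`(k)) (f^`(k.+1) x).
  move=> k3 /cuI Ix; split; first exact: f_diff3.
  by rewrite derive1nS derive1E.
have cf x : c <= x <= u -> {for x, continuous f}.
  move=> /(fk 0 _ isT)[df _]; exact/differentiable_continuous/derivable1_diffP.
have cu : c < u := lt_trans ca (lt_trans ab bu).
have [F [dF ->//]] := continuous_antiderivative cu cf.
have abcu x : a <= x <= b -> c <= x <= u.
  by move=> /andP[ax xb]; apply/andP; split; lra.
have KE (K A : R) : (b - a) ^+ 4 / 6 * K * A = (b - a) ^+ 4 * A / 3 * (K / 2).
  by field.
rewrite KE -(simpson_constE s_gt0).
refine (@norm_simpson_s_convex_le R s a b F f f^`(1) f^`(2) f^`(3) s_gt0 ab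
  _ _ _ _ f3_sconv).
- by move=> x /andP[ax xb]; apply: dF; apply/andP; split; lra.
- by move=> x /abcu; exact: (fk 0%N).
- by move=> x /abcu; exact: (fk 1%N).
- by move=> x /abcu; exact: (fk 2%N).
Qed.
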